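(* Let $k\ge 1$ and let $(\mathcal{P},\mathcal{E})$ be a configuration of order $k$ with $n$ points and $m$ $k$-planes, in which each point is incident with exactly $s$ $k$-planes and each $k$-plane is incident with exactly $t$ points. Then the following hold: (1) $ns=mt$; (2) $k<n-1$.
   Context: A configuration of order $k$ is a pair $(\mathcal{P},\mathcal{E})$, where $\mathcal{P}$ is a finite set whose $n$ elements are called points and $\mathcal{E}$ is a finite set of $m$ (distinct) subsets of $\mathcal{P}$ called $k$-planes, such that: any $k+1$ distinct points are contained together in at most one $k$-plane; every point is incident with the same number $s$ of $k$-planes; every $k$-plane is incident with the same number $t$ of points; $s,t\ge k+1$; and there is some collection of $k$ distinct points that are all contained in more than one $k$-plane. A point $p$ and a $k$-plane $e$ are incident if $p\in e$. *)

(* Defs.v *)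
From mathcomp Require Import all_boot.

Set Implicit Arguments.
Unset Strict Implicit.
Unset Printing Implicit Defensive.

(* The point set is the whole finite type [P], and the k-planes are the members
   of [E]. The constants [s] (planes per point) and [t] (points per plane) are
   parameters: a configuration of order [k] is a pair [(P, E)] for which
   [configuration k s t E] holds for some [s] and [t].
   "Any j distinct points" is rendered as "any set of points of cardinal j". *)
Record configuration (P : finType) (k s t : nat) (E : {set {set P}}) : Prop :=
  Configuration {
    conf_unique_plane : forall A : {set P}, #|A| = k.+1 ->
      #|[set e in E | A \subset e]| <= 1;
    conf_planes_per_point : forall p : P, #|[set e in E | p \in e]| = s;
    conf_points_per_plane : forall e : {set P}, e \in E -> #|e| = t;
    conf_s_ge : k + 1 <= s;
    conf_t_ge : k + 1 <= t;
    conf_shared_points : exists A : {set P},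
      #|A| = k /\ 1 < #|[set e in E | A \subset e]|
  }.

(* Main.v *)
Require Import Defs.
From mathcomp Require Import all_boot.

(** Equality (1) counts incident point-plane pairs in two ways ([sum_card_incident]). For (2), the
    points shared by several planes yield two distinct planes; as both have size [t], their union
    has more than [t] points ([ltn_card_setU_neq]), so [k + 1 <= t < n]. *)

Lemma sum_card_incident (P : finType) (E : {set {set P}}) :
  \sum_(p : P) #|[set e in E | p \in e]| = \sum_(e in E) #|e|.
Proof.
transitivity (\sum_(p : P) \sum_(e in E | p \in e) 1).
  by apply: eq_bigr => p _; rewrite -sum1_card; apply: eq_bigl => e; rewrite inE.
rewrite (exchange_big_dep (mem E)) /=; last by move=> p e _ /andP[].
by apply: eq_bigr => e eE; rewrite -sum1_card; apply: eq_bigl => p; rewrite eE.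
Qed.

(** Equal cardinals would turn an inclusion of [B] in [A] into equality, so [B] has a point outside
    [A]. *)
Lemma ltn_card_setU_neq (P : finType) (A B : {set P}) :
  #|A| = #|B| -> A != B -> #|A| < #|A :|: B|.
Proof.
move=> eqAB neqAB; apply: proper_card; rewrite properE subsetUl /=.
apply: contra neqAB; rewrite subUset => /andP[_ sBA].
by rewrite eq_sym eqEcard sBA eqAB leqnn.
Qed.

Theorem proposition3p1 (P : finType) (E : {set {set P}}) (k n m s t : nat)
  (hk : 1 <= k) (hn : #|P| = n) (hm : #|E| = m)
  (hconf : configuration k s t E) :
  n * s = m * t /\ k < n - 1.
Proof.
case: hconf => _ planes_s points_t _ t_ge [A [_ /card_gt1P]].
move=> [e [f [eA fA neq_ef]]]; split.
  have := sum_card_incident P E.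
  rewrite (eq_bigr (fun=> s)) => [|p _]; last exact: planes_s.
  rewrite [RHS](eq_bigr (fun=> t)) => [|g gE]; last exact: points_t.
  by rewrite !sum_nat_const hn hm.
have [eE fE]: e \in E /\ f \in E by move: eA fA; rewrite !inE => /andP[-> _] /andP[-> _].
(* Two distinct planes of the same size t span more than t >= k + 1 points. *)
have t_lt : t < n.
  rewrite -(points_t e eE) -hn.
  apply: leq_trans (max_card (mem (e :|: f))).
  by apply: ltn_card_setU_neq neq_ef; rewrite !points_t.
(* Truncated subtraction is harmless here: the goal is equivalent to [k + 1 < n]. *)
by rewrite ltn_subRL add1n -addn1; apply: leq_ltn_trans t_lt.
Qed.
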